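(* For every topological space $X$, $$\mathsf G_{\mathrm{fin}}(\mathcal K_X,\mathcal K_X)\leq^+_{\mathrm{II}}\mathsf G_{\mathrm{fin}}(\Omega_X,\Omega_X)\leq^+_{\mathrm{II}}\mathsf G_{\mathrm{fin}}(\mathcal O_X,\mathcal O_X).$$
   Context: No separation axioms are assumed. For a space $X$: $\mathcal O_X$ is the set of all open covers of $X$; $\Omega_X$ is the set of all $\omega$-covers, i.e. open covers $\mathscr U$ such that every finite subset of $X$ is contained in a member of $\mathscr U$; $\mathcal K_X$ is the set of all $k$-covers, i.e. open covers $\mathscr U$ such that every compact subset of $X$ is contained in a member of $\mathscr U$. (Covers are allowed to contain $X$ itself.) $[S]^{<\omega}$ denotes the set of finite subsets of $S$. For sets $\mathcal A,\mathcal B$, the game $\mathsf G_{\mathrm{fin}}(\mathcal A,\mathcal B)$ has length $\omega$: in round $n\in\omega$, P1 plays $A_n\in\mathcal A$ and P2 responds with $\mathscr F_n\in[A_n]^{<\omega}$. P2 wins if $\bigcup\{\mathscr F_n:n\in\omega\}\in\mathcal B$; otherwise P1 wins. For such a game $\mathcal G=\mathsf G_{\mathrm{fin}}(\mathcal A,\mathcal B)$: - $\mathrm{II}\uparrow\mathcal G$: P2 has a winning strategy (a function assigning to each non-empty finite sequence $\langle A_0,\dots,A_n\rangle$ in $\mathcal A$ an element of $[A_n]^{<\omega}$, which wins every run). - $\mathrm{II}\underset{\mathrm{mark}}{\uparrow}\mathcal G$: P2 has a winning Markov strategy, i.e. a winning strategy depending only on P1's most recent move and the round number (a function $\sigma$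 on $\mathcal A\times\omega$ with $\sigma(A,n)\in[A]^{<\omega}$). - $\mathrm I\uparrow\mathcal G$: P1 has a winning strategy (a function from finite sequences of moves of P2 to $\mathcal A$, which wins every run). - $\mathrm I\underset{\mathrm{pre}}{\uparrow}\mathcal G$: P1 has a winning predetermined strategy, i.e. one depending only on the round number (a function $\omega\to\mathcal A$). - $\mathrm I\underset{\mathrm{cnst}}{\uparrow}\mathcal G$: there is a single $A_0\in\mathcal A$ such that playing $A_0$ in every round is a winning strategy for P1. A negated arrow denotes the negation of the corresponding statement. For games $\mathcal G,\mathcal H$, $\mathcal G\leq^+_{\mathrm{II}}\mathcal H$ means that all of the following hold: (i) $\mathrm{II}\underset{\mathrm{mark}}{\uparrow}\mathcal G\Rightarrow\mathrm{II}\underset{\mathrm{mark}}{\uparrow}\mathcal H$; (ii) $\mathrm{II}\uparrow\mathcal G\Rightarrow\mathrm{II}\uparrow\mathcal H$; (iii) $\mathrm I\not\uparrow\mathcal G\Rightarrow\mathrm I\not\uparrow\mathcal H$; (iv) $\mathrm I\underset{\mathrm{pre}}{\not\uparrow}\mathcal G\Rightarrow\mathrm I\underset{\mathrm{pre}}{\not\uparrow}\mathcal H$; (v) $\mathrm I\underset{\mathrm{cnst}}{\not\uparrow}\mathcal G\Rightarrow\mathrm I\underset{\mathrm{cnst}}{\not\uparrow}\mathcal H$. *)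

(* Defs.v *)
From HB Require Import structures.
From mathcomp Require Import all_boot all_order.
From mathcomp Require Import boolp classical_sets functions cardinality.
From mathcomp Require Import topology.

Set Implicit Arguments.
Unset Strict Implicit.
Unset Printing Implicit Defensive.

Local Open Scope classical_set_scope.

Section Covers.
Variable X : topologicalType.

Definition open_covers : set (set (set X)) :=
  [set U | (forall V, U V -> open V) /\ \bigcup_(V in U) V = [set: X]].

Definition omega_covers : set (set (set X)) :=
  [set U | open_covers U /\
           forall F : set X, finite_set F -> exists2 V, U V & F `<=` V].

Definition k_covers : set (set (set X)) :=
  [set U | open_covers U /\
           forall K : set X, compact K -> exists2 V, U V & K `<=` V].

End Covers.

Definition fin_subsets (T : Type) (A : set T) : set (set T) :=
  [set F | finite_set F /\ F `<=` A].

(* [Gfin P Q] stands for G_fin(P, Q): the game is determined by the family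
   [p1_moves] P1 chooses from and the family [target] that P2 aims for. *)
Record fin_game (T : Type) : Type :=
  Gfin { p1_moves : set (set T); target : set (set T) }.

Section Strategies.
Variables (T : Type) (G : fin_game T).

Definition p2_moves : set (set T) :=
  [set F | exists2 A, p1_moves G A & fin_subsets A F].

Definition p2_wins (F : nat -> set T) : Prop :=
  target G (\bigcup_n F n).

(* Strategies are total functions, required to return legal moves only on legal
   inputs; values on other inputs are irrelevant. *)

Definition II_wins : Prop :=
  exists sigma : seq (set T) -> set T,
    (forall (s : seq (set T)) (A : set T),
       [set` s] `<=` p1_moves G -> p1_moves G A ->
       fin_subsets A (sigma (rcons s A))) /\
    (forall A : nat -> set T, (forall n, p1_moves G (A n)) ->
       p2_wins (fun n => sigma (mkseq A n.+1))).

Definition II_mark_wins : Prop :=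
  exists sigma : set T -> nat -> set T,
    (forall (A : set T) (n : nat), p1_moves G A ->
       fin_subsets A (sigma A n)) /\
    (forall A : nat -> set T, (forall n, p1_moves G (A n)) ->
       p2_wins (fun n => sigma (A n) n)).

Definition I_wins : Prop :=
  exists sigma : seq (set T) -> set T,
    (forall s : seq (set T), [set` s] `<=` p2_moves ->
       p1_moves G (sigma s)) /\
    (forall F : nat -> set T,
       (forall n, fin_subsets (sigma (mkseq F n)) (F n)) -> ~ p2_wins F).

Definition I_pre_wins : Prop :=
  exists sigma : nat -> set T,
    (forall n, p1_moves G (sigma n)) /\
    (forall F : nat -> set T,
       (forall n, fin_subsets (sigma n) (F n)) -> ~ p2_wins F).

Definition I_cnst_wins : Prop :=
  exists A0 : set T,
    p1_moves G A0 /\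
    (forall F : nat -> set T,
       (forall n, fin_subsets A0 (F n)) -> ~ p2_wins F).

End Strategies.

Definition leII_plus (S T : Type) (G : fin_game S) (H : fin_game T) : Prop :=
  [/\ II_mark_wins G -> II_mark_wins H,
      II_wins G -> II_wins H,
      ~ I_wins G -> ~ I_wins H,
      ~ I_pre_wins G -> ~ I_pre_wins H
    & ~ I_cnst_wins G -> ~ I_cnst_wins H].

(* Main.v *)
(** Both comparisons translate moves: a cover [U] played by P1 in the harder
    game is encoded as the cover of those open [V] that a finite part of [U]
    "handles", and P2's finite answer is decoded by replacing each [V] by such
    a finite part.

    For [Omega -> O], [G] handles [V] when it covers [V].  For [K -> Omega], in
    round [n], [G] handles [V] when every subset of [V] with at most [n] points
    lies in a single member of [G]; by a tube-lemma argument these [V] form a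
    k-cover.  A finite set [S] with [m] points is then captured as soon as some
    [V] containing [S] is selected in a round [n >= m].  When [X] is not
    compact, [V = X] can be excluded; enlarging [S] by one point outside each
    of the finitely many [V] selected before round [m] forces a late round.
    When [X] is compact, [X] itself is always handled, and P2 decodes it in
    every round. *)
Require Import Defs.
From mathcomp Require Import all_boot all_order.
From mathcomp Require Import boolp classical_sets topology.
From mathcomp Require Import cardinality.

Set Implicit Arguments.
Unset Strict Implicit.
Unset Printing Implicit Defensive.

Local Open Scope classical_set_scope.

(** * Transfer of strategies along an encoding of covers and a decoding of answers *)

Section Translation.
Variables (S T : Type) (G : fin_game S) (H : fin_game T).
Variables (enc : nat -> set T -> set S) (dec : nat -> set T -> set S -> set T).
Hypothesis encP : forall n A, p1_moves H A -> p1_moves G (enc n A).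
Hypothesis decP : forall n A F, p1_moves H A -> finite_set F ->
  fin_subsets A (dec n A F).
Hypothesis decW : forall A F, (forall n, p1_moves H (A n)) ->
  (forall n, fin_subsets (enc n (A n)) (F n)) ->
  p2_wins G F -> p2_wins H (fun n => dec n (A n) (F n)).

Lemma II_mark_wins_translation : II_mark_wins G -> II_mark_wins H.
Proof.
move=> [sigma [sigmaP sigmaW]].
exists (fun A n => dec n A (sigma (enc n A) n)); split=> [A n HA|A HA].
  by apply: decP => //; have [] := sigmaP _ n (encP n HA).
apply: decW => // [n|]; first by apply: sigmaP; exact: encP.
by apply: (sigmaW (fun n => enc n (A n))) => n; exact: encP.
Qed.

Let enc_seq (s : seq (set T)) := mkseq (fun i => enc i (nth set0 s i)) (size s).

Let enc_seq_rcons s A :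
  enc_seq (rcons s A) = rcons (enc_seq s) (enc (size s) A).
Proof.
rewrite /enc_seq size_rcons mkseqS nth_rcons ltnn eqxx; congr rcons.
apply/eq_in_map => i; rewrite mem_iota add0n => /andP[_ ltis].
by rewrite nth_rcons ltis.
Qed.

Lemma II_wins_translation : II_wins G -> II_wins H.
Proof.
move=> [sigma [sigmaP sigmaW]].
(* [s] ends with the current move, so the round number is [(size s).-1], and on legal histories
   [last] never falls back on [set0]. *)
exists (fun s => dec (size s).-1 (last set0 s) (sigma (enc_seq s))).
split=> [s A Hs HA|A HA].
  rewrite last_rcons size_rcons; apply: decP => //.
  rewrite enc_seq_rcons.
  have [] // := sigmaP (enc_seq s) (enc (size s) A) _ (encP _ HA).
  move=> B /= /mapP[i]; rewrite mem_iota add0n => /andP[_ ltis] ->.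
  by apply/encP/Hs => /=; exact: mem_nth.
pose B n := enc n (A n).
have BP n : p1_moves G (B n) by exact: encP.
have encA n : enc_seq (mkseq A n) = mkseq B n.
  rewrite /enc_seq size_mkseq; apply/eq_in_map => i.
  by rewrite mem_iota add0n => /andP[_ ltin]; rewrite nth_mkseq.
have -> : (fun n => dec (size (mkseq A n.+1)).-1 (last set0 (mkseq A n.+1))
      (sigma (enc_seq (mkseq A n.+1)))) =
    (fun n => dec n (A n) (sigma (mkseq B n.+1))).
  by apply/funext => n; rewrite encA size_mkseq mkseqS last_rcons.
apply: decW => // [n|]; last exact: sigmaW.
rewrite mkseqS; apply: sigmaP => [C /= /mapP[i _ ->]|]; exact: BP.
Qed.

Lemma I_pre_wins_translation : I_pre_wins H -> I_pre_wins G.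
Proof.
move=> [sigma [sigmaP sigmaW]]; exists (fun n => enc n (sigma n)).
split=> [n|F FP FW]; first exact: encP.
apply: (sigmaW (fun n => dec n (sigma n) (F n))); last exact: decW.
by move=> n; apply: decP => //; have [] := FP n.
Qed.

Lemma I_wins_translation : I_wins H -> I_wins G.
Proof.
move=> [sigma [sigmaP sigmaW]].
(* Decoding an answer needs the cover it answers, and [sigma] computes that cover from the answers
   decoded so far: hence a left fold, with [size b] as the round number. *)
pose dec_step b F := rcons b (dec (size b) (sigma b) F).
pose dec_seq (s : seq (set S)) := foldl dec_step [::] s.
have dec_rcons s F : dec_seq (rcons s F) = dec_step (dec_seq s) F.
  by rewrite /dec_seq -cats1 foldl_cat.
have dec_moves s : [set` s] `<=` p2_moves G -> [set` dec_seq s] `<=` p2_moves H.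
  elim/last_ind: s => [|s F IHs] sP B /=; first by rewrite in_nil.
  have sP' : [set` s] `<=` p2_moves G.
    by move=> C /= Cs; apply: sP => /=; rewrite mem_rcons in_cons Cs orbT.
  rewrite dec_rcons mem_rcons in_cons => /orP[/eqP ->|]; last exact: IHs.
  have HA := sigmaP _ (IHs sP').
  exists (sigma (dec_seq s)) => //; apply: decP => //.
  by have [|A _ []] := sP F; first by rewrite /= mem_rcons mem_head.
exists (fun s => enc (size s) (sigma (dec_seq s))); split=> [s sP|F FP FW].
  exact/encP/sigmaP/dec_moves.
pose A n := sigma (dec_seq (mkseq F n)).
have FP' n : fin_subsets (enc n (A n)) (F n).
  by have := FP n; rewrite size_mkseq.
pose B n := dec n (A n) (F n).
have decF n : dec_seq (mkseq F n) = mkseq B n.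
  elim: n => // n IHn; rewrite !mkseqS dec_rcons /dec_step IHn size_mkseq.
  by rewrite /B /A IHn.
have FM n : [set` mkseq F n] `<=` p2_moves G.
  elim: n => [|n IHn] C /=; first by rewrite in_nil.
  rewrite mkseqS mem_rcons in_cons => /orP[/eqP ->|]; last exact: IHn.
  exists (enc n (A n)); last exact: FP'.
  exact/encP/sigmaP/dec_moves.
have AP n : p1_moves H (A n) by exact/sigmaP/dec_moves.
apply: (sigmaW B); last exact: decW.
move=> n; rewrite -decF; apply: decP; first exact: AP.
by have [] := FP' n.
Qed.

(* In the constant game P1's encoded moves still depend on the round, so P2
   wins countably many separate plays, one against each [enc n A], and
   interleaves the answers. *)
Lemma I_cnst_wins_translation :
  (forall A F, p1_moves H A ->
     (forall n j, fin_subsets (enc n A) (F n j)) ->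
     (forall n, p2_wins G (F n)) ->
     target H (\bigcup_n \bigcup_j dec n A (F n j))) ->
  I_cnst_wins H -> I_cnst_wins G.
Proof.
move=> decC [A [HA AW]]; apply: contrapT => Gwin.
(* Repeating [enc n A] does not win for P1, so for each [n] P2 has a winning play against it. *)
have /choice[F FP] n : exists F : nat -> set S,
    (forall j, fin_subsets (enc n A) (F j)) /\ p2_wins G F.
  apply: contrapT => noF; apply: Gwin; exists (enc n A).
  split; first exact: encP.
  by move=> F FP FW; apply: noF; exists F.
(* Round [k] answers as round [nj.2] of play [nj.1]; a [k] that codes no pair gets the empty
   answer. *)
pose B k := if unpickle k is Some nj then dec nj.1 A (F nj.1 nj.2) else set0.
apply: (AW B) => [k|].
  rewrite /B; case: unpickle => [[n j]|]; last first.
    by split; [exact: finite_set0|exact: sub0set].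
  by apply: decP => //; have [/(_ j)[]] := FP n.
suff -> : p2_wins H B = target H (\bigcup_n \bigcup_j dec n A (F n j)).
  by apply: decC => // n; have [] := FP n.
congr (target H _); apply/seteqP; split=> [x [k _]|x [n _ [j _ Fx]]].
  by rewrite /B; case: unpickle => // -[n j] /= Fx; exists n => //; exists j.
by exists (pickle (n, j)) => //; rewrite /B pickleK.
Qed.

End Translation.

(** * Sets handled by finite parts of a cover *)

Section Handling.
Variables (X : Type) (Q : set (set X) -> set X -> Prop).

Definition handled (U : set (set X)) : set (set X) :=
  [set V | exists2 G, fin_subsets U G & Q G V].

Definition handler (U : set (set X)) (V : set X) : set (set X) :=
  xget set0 [set G | fin_subsets U G /\ Q G V].

Lemma handlerP U V :
  handled U V -> fin_subsets U (handler U V) /\ Q (handler U V) V.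
Proof.
by move=> [G GU GV]; apply: (@xgetPex _ _ [set G | fin_subsets U G /\ Q G V]); exists G.
Qed.

(** Intersecting with [handled] makes the result a finite part of [U] for every finite [F], even one
    that is not a legal answer. *)
Definition decode (U F : set (set X)) : set (set X) :=
  \bigcup_(V in F `&` handled U) handler U V.

Lemma decode_fin_subsets U F : finite_set F -> fin_subsets U (decode U F).
Proof.
move=> Ffin; split.
  apply: bigcup_finite => [|V [_ /handlerP[[]]]//].
  exact: sub_finite_set (@subIsetl _ _ _) Ffin.
by move=> W [V [_ /handlerP[[_ sub] _]]] /sub.
Qed.

End Handling.

(** * Compactness and the tube lemma *)

Section Spaces.
Variable X : topologicalType.
Implicit Types (U G F : set (set X)) (K V W N : set X) (s : seq X).

(** If [P K] failed, the sets containing [K] minus some [P]-set would form a proper filter. Its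
    cluster point in [K] would have a neighbourhood satisfying [P], and that neighbourhood misses a
    member of the filter. *)
Lemma compact_ind (P : set X -> Prop) K : compact K ->
  P set0 -> (forall A B, A `<=` B -> P B -> P A) ->
  (forall A B, P A -> P B -> P (A `|` B)) ->
  (forall x, K x -> exists2 N, nbhs x N & P N) -> P K.
Proof.
move=> Kc P0 Psub PU Ploc; apply: contrapT => nPK.
pose F : set_system X := [set A | exists2 B, P B & K `\` B `<=` A].
have FF : ProperFilter F.
  split; first by move=> [B PB KB]; apply/nPK/(Psub _ B) => // x Kx;
    apply: contrapT => Bx; apply: (KB x).
  split=> [|A A' [B PB KB] [B' PB' KB']|A A' AA' [B PB KB]].
  - by exists set0.
  - exists (B `|` B'); first exact: PU.
    by move=> x [Kx nBx]; split; [apply: KB|apply: KB']; split=> // Bx;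
      apply: nBx; [left|right].
  - by exists B => //; exact: subset_trans KB AA'.
have FK : F K by exists set0 => // x [].
have [x [Kx clx]] := Kc F FF FK.
have [N Nx PN] := Ploc x Kx.
have [|y [[_ nNy] Ny]] := clx (K `\` N) N _ Nx; first by exists N.
exact: nNy.
Qed.

Lemma fin_subsetsU U G G' : fin_subsets U G -> fin_subsets U G' ->
  fin_subsets U (G `|` G').
Proof.
move=> [Gf GU] [Gf' GU']; split; first by rewrite finite_setU.
by move=> V [/GU|/GU'].
Qed.

Lemma compact_finite_subcover U K : open_covers U -> compact K ->
  exists2 G, fin_subsets U G & K `<=` \bigcup_(V in G) V.
Proof.
move=> [Uo Uc] Kc.
apply: (compact_ind (P := fun C => exists2 G, fin_subsets U G &
  C `<=` \bigcup_(V in G) V) Kc).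
- by exists set0 => //; split; [exact: finite_set0|exact: sub0set].
- by move=> A B AB [G GU BG]; exists G => //; exact: subset_trans AB BG.
- move=> A B [G GU AG] [G' GU' BG]; exists (G `|` G').
    exact: fin_subsetsU.
  by move=> x [/AG|/BG] [V GV Vx]; exists V => //; [left|right].
move=> x _; have [V UV Vx] : (\bigcup_(V in U) V) x by rewrite Uc.
exists V; first by apply: open_nbhs_nbhs; split => //; exact: Uo.
exists [set V]; last by move=> y Vy; exists V.
by split; [exact: finite_set1|move=> _ ->].
Qed.

Definition covers_tuples n G V : Prop :=
  forall s, (size s <= n)%N -> [set` s] `<=` V -> exists2 W, G W & [set` s] `<=` W.

(* [N] plays the role of the coordinates already fixed, all kept in a single
   neighbourhood so that the induction on [n] needs no product space. *)
Lemma omega_cover_tube U K n (E : set X) :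
  omega_covers U -> compact K -> finite_set E ->
  exists N V G, [/\ open N /\ E `<=` N, open V /\ K `<=` V, fin_subsets U G &
    forall s, (size s <= n)%N -> [set` s] `<=` V ->
      exists2 W, G W & N `|` [set` s] `<=` W].
Proof.
move=> [[Uo Uc] Uom] Kc; elim: n E => [|n IHn] E Efin.
  have [W UW EW] := Uom E Efin.
  exists W, setT, [set W]; split.
  - by split=> //; exact: Uo.
  - by split=> //; exact: openT.
  - by split; [exact: finite_set1|move=> _ ->].
  move=> [|//] _ _; exists W => //.
  by move=> x [//|] /=; rewrite in_nil.
(* One coordinate [y] is split off: it ranges over [D], the remaining ones over [V]. *)
pose good D N V G := forall y s, D y -> (size s <= n)%N -> [set` s] `<=` V ->
  exists2 W, G W & N `|` (y |` [set` s]) `<=` W.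
have [D [N [V [G [[Do KD] [No EN] [Vo KV] GU gd]]]]] :
    exists D N V G, [/\ open D /\ K `<=` D, open N /\ E `<=` N,
      open V /\ K `<=` V, fin_subsets U G & good D N V G].
  (* Compactness in [y]: for a union, [D] and [G] grow by union while [N] and [V] shrink by
     intersection. *)
  apply: (compact_ind (P := fun C => exists D N V G, [/\ open D /\ C `<=` D,
    open N /\ E `<=` N, open V /\ K `<=` V, fin_subsets U G & good D N V G]) Kc).
  - exists set0, setT, setT, set0; split=> //.
    + by split=> //; exact: open0.
    + by split=> //; exact: openT.
    + by split=> //; exact: openT.
    + by split; [exact: finite_set0|exact: sub0set].
  - move=> A B AB [D [N [V [G [[Do BD] ? ? ? ?]]]]].
    by exists D, N, V, G; split=> //; split=> //; exact: subset_trans AB BD.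
  - move=> A B [D [N [V [G [[Do AD] [No EN] [Vo KV] GU gd]]]]].
    move=> [D' [N' [V' [G' [[Do' BD'] [No' EN'] [Vo' KV'] GU' gd']]]]].
    exists (D `|` D'), (N `&` N'), (V `&` V'), (G `|` G'); split.
    + by split; [exact: openU|exact: setUSS].
    + by split; [exact: openI|rewrite subsetI].
    + by split; [exact: openI|rewrite subsetI].
    + exact: fin_subsetsU.
    move=> y s [Dy|Dy] sn; rewrite subsetI => -[sV sV'].
      have [W GW NW] := gd y s Dy sn sV; exists W; first by left.
      by move=> x [[Nx _]|yx]; apply: NW; [left|right].
    have [W GW NW] := gd' y s Dy sn sV'; exists W; first by right.
    by move=> x [[_ Nx]|yx]; apply: NW; [left|right].
  move=> x Kx.
  (* Fixing [x] along with [E] yields one neighbourhood [N] of both, which serves as [D] and as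
     [N]. *)
  have [|N [V [G [[No xEN] [Vo KV] GU gd]]]] := IHn (x |` E).
    by rewrite finite_setU; split=> //; exact: finite_set1.
  exists N.
    by apply: open_nbhs_nbhs; split=> //; apply: xEN; left.
  exists N, N, V, G; split=> //.
  - by split.
  - by split=> //; apply: subset_trans xEN; exact: subsetUr.
  move=> y s Ny sn sV; have [W GW NW] := gd s sn sV; exists W => //.
  by move=> z [Nz|[->|sz]]; apply: NW; [left|left|right].
(* A second use of the induction hypothesis serves the empty tuple, which has no coordinate [y]. *)
have [N' [V' [G' [[No' EN'] [Vo' KV'] GU' gd']]]] := IHn E Efin.
exists (N `&` N'), (D `&` V `&` V'), (G `|` G'); split.
- by split; [exact: openI|rewrite subsetI].
- by split; [do 2?apply: openI|rewrite !subsetI].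
- exact: fin_subsetsU.
move=> [_ _|y s sn]; last rewrite !subsetI.
  have nilV' : [set` [::]] `<=` V' by move=> x /=; rewrite in_nil.
  have [W GW NW] := gd' [::] (leq0n n) nilV'.
  exists W; first by right.
  by move=> x [[_ Nx]|]; [apply: NW; left|rewrite /= in_nil].
move=> [[sD sV] _].
have Dy : D y by apply: sD => /=; rewrite mem_head.
have sV1 : [set` s] `<=` V.
  by move=> x /= xs; apply: sV; rewrite /= in_cons xs orbT.
have [W GW NW] := gd y s Dy sn sV1.
exists W; first by left.
move=> x [[Nx _]|/=]; first by apply: NW; left.
by rewrite in_cons => /orP[/eqP ->|xs]; apply: NW; right; [left|right].
Qed.

(** Take a filter with no cluster point in [K]. Each point of [K] has an open neighbourhood disjoint
    from a member of the filter, hence so does [K]; that member is nonempty, so the neighbourhood is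
    not the whole space. *)
Lemma compact_proper_nbhd K : compact K -> ~ compact [set: X] ->
  exists V, [/\ open V, K `<=` V & V <> setT].
Proof.
move=> Kc nXc; apply: contrapT => noV; apply: nXc => F FF _.
have [x [Kx clx]] : K `&` cluster F !=set0; last by exists x.
apply: contrapT => ncl; apply: noV.
have {}ncl x : K x -> exists A N, [/\ F A, open_nbhs x N & A `&` N = set0].
  move=> Kx; apply: contrapT => noAN; apply: ncl; exists x; split=> // A N FA.
  rewrite nbhsE => -[N' xN' N'N]; apply: contrapT => AN; apply: noAN.
  exists A, N'; split=> //; rewrite -subset0 => y [Ay Ny].
  by apply: AN; exists y; split=> //; exact: N'N.
have [V [Vo KV [A FA AV]]] : exists V, [/\ open V, K `<=` V &
    exists2 A, F A & A `&` V = set0].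
  apply: (compact_ind (P := fun C => exists V, [/\ open V, C `<=` V &
    exists2 A, F A & A `&` V = set0]) Kc).
  - exists set0; split=> //; first exact: open0.
    by exists setT; [exact: filterT|rewrite setI0].
  - move=> C B CB [V [Vo BV ?]]; exists V; split=> //.
    exact: subset_trans CB BV.
  - move=> C B [V [Vo CV [A FA AV]]] [V' [Vo' BV' [A' FA' AV']]].
    exists (V `|` V'); split; [exact: openU|exact: setUSS|].
    exists (A `&` A'); first exact: filterI.
    rewrite -subset0 => y [[Ay A'y] [Vy|Vy]].
      by rewrite -AV.
    by rewrite -AV'.
  move=> x /ncl[A [N [FA [No Nx] AN]]].
  exists N; first exact: open_nbhs_nbhs.
  by exists N; split=> //; exists A.
exists V; split=> // VT; move: AV; rewrite VT setIT => A0.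
by apply: (@filter_not_empty _ F); rewrite -A0.
Qed.

(** * From k-covers to omega-covers *)

Definition tuple_encoding n U : set (set X) :=
  [set V | [/\ open V, compact [set: X] \/ V <> setT &
               handled (covers_tuples n) U V]].

Lemma k_covers_tuple_encoding n U :
  omega_covers U -> k_covers (tuple_encoding n U).
Proof.
move=> Uom.
have encK K : compact K -> exists2 V, tuple_encoding n U V & K `<=` V.
  move=> Kc.
  have [N [V [G [_ [Vo KV] GU gd]]]] := omega_cover_tube n Uom Kc (finite_set0 X).
  have [V' [Vo' KV' V'T]] : exists V', [/\ open V', K `<=` V' &
      compact [set: X] \/ V' <> setT].
    have [Xc|nXc] := pselect (compact [set: X]).
      by exists setT; split; [exact: openT|exact: subsetT|left].
    have [V' [? ? ?]] := compact_proper_nbhd Kc nXc.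
    by exists V'; split=> //; right.
  (* Subsets of a handled set are handled, so the tube may be cut down to [V']. *)
  exists (V `&` V'); last by rewrite subsetI.
  split; first exact: openI.
    have [?|V'NT] := V'T; first by left.
    right=> VV'; apply: V'NT; rewrite -subTset -VV'; exact: subIsetr.
  exists G => // s sn; rewrite subsetI => -[sV _].
  have [W GW sW] := gd s sn sV; exists W => //.
  by move=> x sx; apply: sW; right.
split=> //; split=> [V []//|].
rewrite -subTset => x _.
have [V encV xV] := encK _ (@compact_set1 _ x).
by exists V => //; exact: xV.
Qed.

(** [setT] is inserted whether or not P2 chose it; [decode] drops it when it is not handled. *)
Definition tuple_decoding n U F : set (set X) :=
  decode (covers_tuples n) U (setT |` F).

Lemma tuple_decoding_fin_subsets n U F :
  finite_set F -> fin_subsets U (tuple_decoding n U F).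
Proof.
move=> Ff; apply: decode_fin_subsets.
by rewrite finite_setU; split=> //; exact: finite_set1.
Qed.

Lemma tuple_decoding_mem n U F V s : tuple_encoding n U V -> (setT |` F) V ->
  (size s <= n)%N -> [set` s] `<=` V ->
  exists2 W, tuple_decoding n U F W & [set` s] `<=` W.
Proof.
move=> [_ _ encV] FV sn sV; have [_ QV] := handlerP encV.
have [W GW sW] := QV s sn sV; exists W => //.
by exists V => //; split.
Qed.

Lemma omega_coversW (B : set (set X)) : (forall V, B V -> open V) ->
  (forall s, exists2 W, B W & [set` s] `<=` W) -> omega_covers B.
Proof.
move=> Bo Bs; split; last by move=> E /finite_seqP[s ->].
split=> //; rewrite -subTset => x _.
have [W BW sW] := Bs [:: x]; exists W => //.
by apply: sW; rewrite /= mem_head.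
Qed.

Lemma avoiding_finite_set F : finite_set F -> (forall V, F V -> V <> setT) ->
  exists2 E, finite_set E & forall V, F V -> ~ E `<=` V.
Proof.
move=> Ff FT.
have /choice[q qP] V : exists E : set X,
    finite_set E /\ (V <> setT -> ~ E `<=` V).
  have [->|VT] := pselect (V = setT).
    by exists set0; split=> //; exact: finite_set0.
  have [x nVx] : exists x, ~ V x.
    apply: contrapT => noX; apply: VT; rewrite -subTset => x _.
    by apply: contrapT => nVx; apply: noX; exists x.
  exists [set x]; split; first exact: finite_set1.
  by move=> _ /(_ x erefl).
exists (\bigcup_(V in F) q V).
  by apply: bigcup_finite => // V _; have [] := qP V.
move=> V FV FqV; have [_ /(_ (FT V FV))] := qP V; apply.
by apply: subset_trans FqV => x qx; exists V.
Qed.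

Lemma tuple_decoding_wins (A F : nat -> set (set X)) :
  (forall n, omega_covers (A n)) ->
  (forall n, fin_subsets (tuple_encoding n (A n)) (F n)) ->
  k_covers (\bigcup_n F n) ->
  omega_covers (\bigcup_n tuple_decoding n (A n) (F n)).
Proof.
move=> Aom FP [_ Fk]; apply: omega_coversW => [V [n _ decV]|s].
  have [[Ao _] _] := Aom n; apply: Ao.
  by have [_] := tuple_decoding_fin_subsets n (A n) (proj1 (FP n)); apply.
suff [n [V [encV FV sn sV]]] : exists n V, [/\ tuple_encoding n (A n) V,
    (setT |` F n) V, (size s <= n)%N & [set` s] `<=` V].
  have [W decW sW] := tuple_decoding_mem encV FV sn sV.
  by exists W => //; exists n.
have [Xc|nXc] := pselect (compact [set: X]).
  (* The encoding is a k-cover, so some member contains the compact whole space and thus equals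
     [setT]. *)
  exists (size s), setT; split=> //; last by left.
  have [_ encK] := k_covers_tuple_encoding (size s) (Aom (size s)).
  have [V encV] := encK _ Xc; rewrite subTset => VT.
  by rewrite VT in encV.
(* Legal answers omit [setT] here, so a finite [E] escapes every set chosen before round
   [size s]. *)
have [||E Ef EP] := @avoiding_finite_set (\bigcup_(n in `I_(size s)) F n).
- by apply: bigcup_finite => [|n _]; [exact: finite_II|have [] := FP n].
- by move=> V [n _ FV]; have [_ /(_ V FV)[_ []]] := FP n.
have Kc : compact ([set` s] `|` E).
  by apply: finite_compact; rewrite finite_setU; split=> //; exact: finite_seq.
have [V [n _ FV]] := Fk _ Kc; rewrite subUset => -[sV EV].
exists n, V; split=> //; [|by right|].
  by have [_] := FP n; apply.
rewrite leqNgt; apply/negP => ns; apply: (EP V) => //.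
by exists n.
Qed.

(** Each round number now has a whole winning play of its own, so a tuple [s] is captured in play
    [size s], without a case split on compactness. *)
Lemma tuple_decoding_wins_cnst U (F : nat -> nat -> set (set X)) :
  omega_covers U ->
  (forall n j, fin_subsets (tuple_encoding n U) (F n j)) ->
  (forall n, k_covers (\bigcup_j F n j)) ->
  omega_covers (\bigcup_n \bigcup_j tuple_decoding n U (F n j)).
Proof.
move=> Uom FP Fk; apply: omega_coversW => [V [n _ [j _ decV]]|s].
  have [[Uo _] _] := Uom; apply: Uo.
  by have [_] := tuple_decoding_fin_subsets n U (proj1 (FP n j)); apply.
have [_ /(_ [set` s])[|V [j _ FV] sV]] := Fk (size s).
  by apply: finite_compact; exact: finite_seq.
have encV : tuple_encoding (size s) U V by have [_] := FP (size s) j; apply.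
have [W decW sW] := tuple_decoding_mem encV (or_intror FV) (leqnn _) sV.
by exists W => //; exists (size s) => //; exists j.
Qed.

Theorem k_leII_omega :
  leII_plus (Gfin (@k_covers X) (@k_covers X))
            (Gfin (@omega_covers X) (@omega_covers X)).
Proof.
set G := Gfin (@k_covers X) _; set H := Gfin (@omega_covers X) _.
have encP n U : omega_covers U -> k_covers (tuple_encoding n U).
  exact: k_covers_tuple_encoding.
have decP n U F : omega_covers U -> finite_set F ->
    fin_subsets U (tuple_decoding n U F).
  by move=> _; exact: tuple_decoding_fin_subsets.
split; [| |apply: contra_not..].
- exact: (II_mark_wins_translation (G := G) (H := H)
    (dec := tuple_decoding) encP decP tuple_decoding_wins).
- exact: (II_wins_translation (G := G) (H := H)
    (dec := tuple_decoding) encP decP tuple_decoding_wins).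
- exact: (I_wins_translation (G := G) (H := H)
    (dec := tuple_decoding) encP decP tuple_decoding_wins).
- exact: (I_pre_wins_translation (G := G) (H := H)
    (dec := tuple_decoding) encP decP tuple_decoding_wins).
- exact: (I_cnst_wins_translation (G := G) (H := H)
    (dec := tuple_decoding) encP decP tuple_decoding_wins_cnst).
Qed.

(** * From omega-covers to open covers *)

Definition covers G V : Prop := V `<=` \bigcup_(W in G) W.

Definition union_encoding U : set (set X) :=
  [set V | open V /\ handled covers U V].

Lemma omega_covers_union_encoding U :
  open_covers U -> omega_covers (union_encoding U).
Proof.
move=> Uc; apply: omega_coversW => [V []//|s].
have [|G GU sG] := @compact_finite_subcover U [set` s] Uc.
  by apply: finite_compact; exact: finite_seq.
exists (\bigcup_(W in G) W) => //; split; last by exists G.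
apply: bigcup_open => W GW; have [Uo _] := Uc; apply: Uo.
by have [_] := GU; apply.
Qed.

Lemma decode_covers U F V x : fin_subsets (union_encoding U) F -> F V -> V x ->
  exists2 W, decode covers U F W & W x.
Proof.
move=> [_ FU] FV Vx; have [_ encV] := FU V FV.
have [_ /(_ x Vx)[W GW Wx]] := handlerP encV.
by exists W => //; exists V.
Qed.

Lemma union_decoding_wins (A F : nat -> set (set X)) :
  (forall n, open_covers (A n)) ->
  (forall n, fin_subsets (union_encoding (A n)) (F n)) ->
  omega_covers (\bigcup_n F n) ->
  open_covers (\bigcup_n decode covers (A n) (F n)).
Proof.
move=> Ac FP [[_ Fc] _]; split=> [V [n _ decV]|].
  have [Ao _] := Ac n; apply: Ao.
  by have [_] := decode_fin_subsets covers (A n) (proj1 (FP n)); apply.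
rewrite -subTset => x _.
have [V [n _ FV] Vx] : (\bigcup_(V in \bigcup_n F n) V) x by rewrite Fc.
have [W decW Wx] := decode_covers (FP n) FV Vx.
by exists W => //; exists n.
Qed.

Theorem omega_leII_open :
  leII_plus (Gfin (@omega_covers X) (@omega_covers X))
            (Gfin (@open_covers X) (@open_covers X)).
Proof.
set G := Gfin (@omega_covers X) _; set H := Gfin (@open_covers X) _.
pose enc (n : nat) := union_encoding; pose dec (n : nat) := decode covers.
have encP n U : open_covers U -> omega_covers (enc n U).
  exact: omega_covers_union_encoding.
have decP n U F : open_covers U -> finite_set F -> fin_subsets U (dec n U F).
  by move=> _; exact: decode_fin_subsets.
have decW := union_decoding_wins.
split; [| |apply: contra_not..].
- exact: (II_mark_wins_translation (G := G) (H := H)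
    (dec := dec) encP decP decW).
- exact: (II_wins_translation (G := G) (H := H) (dec := dec) encP decP decW).
- exact: (I_wins_translation (G := G) (H := H) (dec := dec) encP decP decW).
- exact: (I_pre_wins_translation (G := G) (H := H) (dec := dec) encP decP decW).
apply: (I_cnst_wins_translation (G := G) (H := H) (dec := dec) encP decP).
move=> U F Uc FP Fom.
have [Uo _] := Uc; split=> [V [n _ [j _ decV]]|].
  by apply: Uo; have [_] := decP n U (F n j) Uc (proj1 (FP n j)); apply.
(* The play against [enc 0 U] alone already decodes to a cover. *)
have [_ cov] := union_decoding_wins (fun=> Uc) (FP 0) (Fom 0).
rewrite -subTset -cov => x [V [j _ decV] Vx].
by exists V => //; exists 0 => //; exists j.
Qed.

End Spaces.

Theorem theorem4p45 (X : topologicalType) :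
  leII_plus (Gfin (@k_covers X) (@k_covers X))
            (Gfin (@omega_covers X) (@omega_covers X)) /\
  leII_plus (Gfin (@omega_covers X) (@omega_covers X))
            (Gfin (@open_covers X) (@open_covers X)).
Proof. by split; [exact: k_leII_omega|exact: omega_leII_open]. Qed.
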